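(* Let $X$ be a Banach space. Assume that there exist a weak*-null biorthogonal system $(x_{n,\alpha},\gamma_{n,\alpha})_{n\in\omega,\alpha\in\mathfrak c}$ in $X$ and a constant $C\ge0$ such that $$\Big\Vert\sum_{i=1}^k x_{n_i,\alpha_i}\Big\Vert\le C$$ for all $k\ge1$, all pairwise distinct $n_1,\ldots,n_k\in\omega$, and all $\alpha_1,\ldots,\alpha_k\in\mathfrak c$. Then $\operatorname{Ext}(X,c_0)\ne0$.
   Context: Banach spaces are real. $\mathfrak c$ denotes the cardinality of the continuum, regarded as an (initial) ordinal, and $\omega$ the set of natural numbers. A twisted sum of Banach spaces $Y$ and $X$ is a short exact sequence $0\to Y\to Z\to X\to0$ with $Z$ a Banach space and the maps bounded linear operators; it is trivial if the map $Y\to Z$ admits a bounded linear left inverse (equivalently, the range of $Y\to Z$ is complemented in $Z$). $\operatorname{Ext}(X,Y)=0$ means that every such twisted sum is trivial; $\operatorname{Ext}(X,Y)\ne0$ means that some such twisted sum is nontrivial. A biorthogonal system in $X$ is a family $(x_i,\gamma_i)_{i\in I}$ with $x_i\in X$, $\gamma_i\in X^*$, $\gamma_i(x_i)=1$ and $\gamma_i(x_j)=0$ for $i\ne j$; it is weak*-null if $\big(\gamma_i(x)\big)_{i\in I}\in c_0(I)$ for all $x\in X$. Here the index set is $\omega\times\mathfrak c$. *)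

(* Defs.v *)
From HB Require Import structures.
From mathcomp Require Import all_boot all_order all_algebra.
From mathcomp Require Import boolp classical_sets functions cardinality reals.
From mathcomp Require Import topology normedtype.

Set Implicit Arguments.
Unset Strict Implicit.
Unset Printing Implicit Defensive.

Import Order.TTheory GRing.Theory Num.Theory.
Import numFieldNormedType.Exports.

Local Open Scope classical_set_scope.
Local Open Scope ring_scope.

(* Membership of a real family in c_0(I), for an arbitrary index set I. *)
Definition vanishing (R : realType) (I : Type) (f : I -> R) : Prop :=
  forall e : R, 0 < e -> finite_set [set i | e <= `|f i|].

Section c0_type.
Context (R : realType) (I : Type).

Definition c0_pred : {pred I -> R} := [pred f : I -> R | `[< vanishing f >]].

Lemma c0_predP (f : I -> R) : reflect (vanishing f) (f \in c0_pred).
Proof. exact: asboolP. Qed.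

Lemma c0_submod_closed : submod_closed c0_pred.
Proof.
split=> [|a f g /c0_predP vf /c0_predP vg]; apply/c0_predP => e e0.
  rewrite (_ : [set i | _] = set0) // -subset0 => i /=.
  by rewrite normr0 leNgt e0.
pose d := e / 2 / (`|a| + 1).
have a1 : 0 < `|a| + 1 by rewrite ltr_wpDl.
have e2 : 0 < e / 2 by rewrite divr_gt0.
have d0 : 0 < d by rewrite divr_gt0.
apply: (@sub_finite_set _ _ ([set i | d <= `|f i|] `|` [set i | e / 2 <= `|g i|])).
  2: by rewrite finite_setU; split; [exact: vf|exact: vg].
move=> i /= efg.
have [|gi] := leP (e / 2) `|g i|; [by right|left].
rewrite leNgt; apply/negP => fi.
move: efg; apply/negP; rewrite -ltNge.
apply: (le_lt_trans (ler_normD _ _)); rewrite (splitr e); apply: ltr_leD (ltW gi).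
rewrite [X in `|X|](_ : _ = a * f i) // normrM.
rewrite (@le_lt_trans _ _ ((`|a| + 1) * `|f i|)) //.
  by rewrite ler_wpM2r // lerDl.
by rewrite mulrC -ltr_pdivlMr.
Qed.

Record c0 := C0 { c0_val :> I -> R ; c0_valP : c0_val \in c0_pred }.

HB.instance Definition _ := [isSub for c0_val].
HB.instance Definition _ := [Choice of c0 by <:].
HB.instance Definition _ := GRing.isSubmodClosed.Build R (I -> R) c0_pred
  c0_submod_closed.
HB.instance Definition _ := [SubChoice_isSubLmodule of c0 by <:].


Lemma c0P (f g : c0) : (forall i, f i = g i) -> f = g.
Proof. by move=> fg; apply: val_inj; apply/funext. Qed.

Lemma c0_vanishing (f : c0) : vanishing f.
Proof. exact/c0_predP/c0_valP. Qed.

Lemma c0_0E (i : I) : (0 : c0) i = 0.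
Proof. by []. Qed.

Lemma c0_addE (f g : c0) (i : I) : (f + g) i = f i + g i.
Proof. by []. Qed.

Lemma c0_oppE (f : c0) (i : I) : (- f) i = - f i.
Proof. by []. Qed.

Lemma c0_scaleE (a : R) (f : c0) (i : I) : (a *: f) i = a * f i.
Proof. by []. Qed.

Definition c0_norm (f : c0) : R := sup [set `|f i| | i in [set: I]].

Lemma c0_norm_has_ubound (f : c0) : has_ubound [set `|f i| | i in [set: I]].
Proof.
have : finite_set [set `|f i| | i in [set i | 1 <= `|f i|]].
  by apply: finite_image; exact: c0_vanishing.
move=> /finite_seqP[s sE]; exists (\big[Num.max/1]_(y <- s) y) => _ [i _ <-].
have [fi|/ltW fi] := leP 1 `|f i|; last first.
  by rewrite (le_trans fi) // bigmax_ge_id.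
have fis : `|f i| \in s.
  by have : [set` s] `|f i| by rewrite -sE; exists i.
exact: (@le_bigmax_seq _ _ _ _ 1 _ predT id fis isT).
Qed.

Lemma c0_norm_ub (f : c0) (i : I) : `|f i| <= c0_norm f.
Proof. by apply: ub_le_sup; [exact: c0_norm_has_ubound|exists i]. Qed.

Lemma c0_norm_le (f : c0) (M : R) :
  0 <= M -> (forall i, `|f i| <= M) -> c0_norm f <= M.
Proof.
move=> M0 fM; have [e0|/set0P ne] := eqVneq [set `|f i| | i in [set: I]] set0.
  by rewrite /c0_norm e0 sup0.
by apply: ge_sup => // _ [i _ <-].
Qed.

Lemma c0_norm_ge0 (f : c0) : 0 <= c0_norm f.
Proof.
have [e0|/set0P[_ [i _ _]]] := eqVneq [set `|f i| | i in [set: I]] set0.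
  by rewrite /c0_norm e0 sup0.
exact: le_trans (normr_ge0 _) (c0_norm_ub f i).
Qed.

Lemma c0_ler_normD (f g : c0) : c0_norm (f + g) <= c0_norm f + c0_norm g.
Proof.
apply: c0_norm_le => [|i]; first by rewrite addr_ge0 ?c0_norm_ge0.
by rewrite c0_addE (le_trans (ler_normD _ _)) // lerD ?c0_norm_ub.
Qed.

Lemma c0_normrZ (a : R) (f : c0) : c0_norm (a *: f) = `|a| * c0_norm f.
Proof.
have le b g : c0_norm (b *: g) <= `|b| * c0_norm g.
  apply: c0_norm_le => [|i]; first by rewrite mulr_ge0 ?c0_norm_ge0.
  by rewrite c0_scaleE normrM ler_wpM2l ?c0_norm_ub.
apply/eqP; rewrite eq_le le /=.
have [->|a0] := eqVneq a 0; first by rewrite normr0 mul0r c0_norm_ge0.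
by rewrite -ler_pdivlMl ?normr_gt0 // -normfV -[leLHS]/(c0_norm f)
  -{1}[f]scale1r -(mulVf a0) -scalerA le.
Qed.

Lemma c0_normr0_eq0 (f : c0) : c0_norm f = 0 -> f = 0.
Proof.
move=> f0; apply: c0P => i; apply/eqP; rewrite c0_0E -normr_le0 -f0.
exact: c0_norm_ub.
Qed.

HB.instance Definition _ := @Lmodule_isNormed.Build R c0 c0_norm c0_ler_normD
  c0_normrZ c0_normr0_eq0.

Lemma c0_normE (f : c0) : `|f| = sup [set `|f i| | i in [set: I]].
Proof. by []. Qed.

Lemma c0_complete (F : set_system c0) :
  ProperFilter F -> cauchy F -> cvg F.
Proof.
move=> FF Fc.
have ex e : 0 < e -> exists x : c0, \forall u \near F, `|x - u| < e.
  move=> e0; have /cauchyP/(_ e e0)[x Fx] := Fc.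
  by exists x; apply: filterS Fx => u; rewrite -ball_normE.
pose g i := lim ((fun u : c0 => u i) @ F).
have gP i : (fun u : c0 => u i) @ F --> g i.
  apply: R_complete; apply/cauchyP => e e0.
  have [x Fx] := ex e e0; exists (x i); apply: filterS Fx => u xu.
  rewrite -ball_normE /=; apply: le_lt_trans xu.
  by rewrite -c0_oppE -c0_addE; exact: c0_norm_ub.
have near_g e (x : c0) : (\forall u \near F, `|x - u| < e) ->
    forall i, `|x i - g i| <= e.
  move=> Fx i; apply/ler_addgt0Pr => d d0; near F => u.
  rewrite -[x i - g i](subrKA (u i)) (le_trans (ler_normD _ _)) // lerD //.
    rewrite -c0_oppE -c0_addE (le_trans (c0_norm_ub _ _)) // ltW //.
    by near: u; exact: Fx.
  rewrite distrC; near: u; move/cvgrPdist_le : (gP i); exact.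
have vg : g \in c0_pred.
  apply/c0_predP => e e0; have e2 : 0 < e / 2 by rewrite divr_gt0.
  have [x /near_g xg] := ex _ e2.
  apply: sub_finite_set (c0_vanishing x e2) => i /= ge.
  rewrite -(lerD2r (e / 2)) -splitr (le_trans ge) //.
  rewrite -[g i](subKr (x i)) (le_trans (ler_normB _ _)) // lerD2l.
  exact: xg.
apply/cvg_ex; exists (C0 vg); apply/cvgrPdist_le => /= e e0.
have e2 : 0 < e / 2 by rewrite divr_gt0.
have [x Fx] := ex _ e2; apply: filterS (Fx) => u xu.
apply: c0_norm_le => [|i]; first exact: ltW.
rewrite c0_addE c0_oppE -[C0 vg i]/(g i) -(subrKA (x i)).
rewrite (le_trans (ler_normD _ _)) // (splitr e) lerD //.
  by rewrite distrC; exact: near_g.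
by rewrite -c0_oppE -c0_addE (le_trans (c0_norm_ub _ _)) // ltW.
Unshelve. all: by end_near. Qed.

HB.instance Definition _ := Uniform_isComplete.Build c0 c0_complete.

End c0_type.

(* For sequences, [vanishing] is convergence to 0, so [c0 R nat] is the
   classical space c_0. *)
Lemma vanishing_natP (R : realType) (u : nat -> R) :
  vanishing u <-> (u n @[n --> \oo] --> (0 : R)).
Proof.
split=> [vu|/cvgrPdist_lt u0 e e0].
  apply/cvgrPdist_lt => e e0; have /finite_seqP[s sE] := vu e e0.
  exists (\max_(i <- s) i).+1 => // n /= sn; rewrite sub0r normrN ltNge.
  apply/negP => en; have ns : n \in s.
    by have : [set` s] n by rewrite -sE.
  by have := @leq_bigmax_seq _ s predT id n ns isT; rewrite leqNgt sn.
have [N _ uN] := u0 e e0.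
apply: sub_finite_set (finite_II N) => n /= en; rewrite ltnNge.
by apply/negP => /uN /=; rewrite sub0r normrN ltNge en.
Qed.

Section operators.
Context (R : realType).
Implicit Types V W X Y : completeNormedModType R.

Definition bounded_operator V W (f : {linear V -> W}) : Prop :=
  exists M : R, forall v, `|f v| <= M * `|v|.

Lemma bounded_operatorP V W (f : {linear V -> W}) :
  bounded_operator f <-> continuous f.
Proof.
rewrite -linear_bounded_continuous linear_boundedP; split=> [[M fM]|fM].
  near=> r => v; rewrite (le_trans (fM v)) // ler_wpM2r //.
  by near: r; apply: nbhs_pinfty_ge; exact: num_real.
by have [r ?] := filter_ex fM; exists r.
Unshelve. all: by end_near. Qed.

Definition biorthogonal_system X (I : Type) (x : I -> X)
    (g : I -> {linear X -> R^o}) : Prop :=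
  [/\ forall i, bounded_operator (g i),
      forall i, g i (x i) = 1
    & forall i j, i <> j -> g i (x j) = 0].

Definition weak_star_null X (I : Type) (g : I -> {linear X -> R^o}) : Prop :=
  forall v : X, vanishing (fun i => g i v : R).

(* A short exact sequence 0 -> Y -> Z -> X -> 0 of Banach spaces. *)
Record twisted_sum Y X := TwistedSum {
  ts_mid : completeNormedModType R ;
  ts_inj : {linear Y -> ts_mid} ;
  ts_proj : {linear ts_mid -> X} ;
  ts_inj_bounded : bounded_operator ts_inj ;
  ts_proj_bounded : bounded_operator ts_proj ;
  ts_injective : injective ts_inj ;
  ts_exact : range ts_inj = [set z | ts_proj z = 0] ;
  ts_surjective : range ts_proj = [set: X]
}.

Definition trivial_twisted_sum Y X (t : twisted_sum Y X) : Prop :=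
  exists2 r : {linear ts_mid t -> Y}, bounded_operator r & cancel (ts_inj t) r.

Definition Ext_eq0 X Y : Prop :=
  forall t : twisted_sum Y X, trivial_twisted_sum t.

Definition Ext_neq0 X Y : Prop :=
  exists t : twisted_sum Y X, ~ trivial_twisted_sum t.

Lemma Ext_neq0P X Y : Ext_neq0 X Y <-> ~ Ext_eq0 X Y.
Proof. by split=> [[t nt] /(_ t)|/existsNP]. Qed.

End operators.

(* The cardinality of the continuum.  Only the cardinality of the index set
   matters, so any type of size c can play the role of the ordinal c. *)
Definition card_continuum (R : realType) (A : Type) : Prop :=
  ([set: A] #= [set: R])%card.

(* Main.v *)
Require Import Defs.
From HB Require Import structures.
From mathcomp Require Import all_boot all_order all_algebra.
From mathcomp Require Import boolp classical_sets functions cardinality reals.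
From mathcomp Require Import topology normedtype.
From mathcomp Require Import lra.

(* Every node [s] of the tree of finite sequences lies on the branches of all
   [a : nat -> nat] extending it; put [s] in the set S(n, a) exactly when [a]
   takes the value [n] right after [s].  Adding a private copy of the branch [a]
   for each [n] makes every S(n, a) infinite, and these sets are almost disjoint.
   If a finite set is removed from each S(n, a), then by the Baire category
   theorem some node [s] still belongs, for every [n < k], to S(n, a_n) for some
   [a_n], so that k sets with distinct first indices meet at a common point.

   The twisted sum is the pullback of 0 -> c_0 -> l_oo -> l_oo / c_0 -> 0 along
   v |-> sum_i gamma_i(v) [1_(S i)], written out concretely as a space of pairs
   (z, v) with z in l_oo.  A bounded retraction r onto c_0 yields the operator
   T (z, v) = z - r (z, v), which depends only on v; T sends any lift of x_i to a
   sequence close to 1 on S(i) up to a finite set, so at a common point of k of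
   the sets T (x_(n_1, a_1) + ... + x_(n_k, a_k)) is at least k / 2, whereas these
   sums have lifts of norm at most 1 + C. *)

Set Implicit Arguments.
Unset Strict Implicit.
Unset Printing Implicit Defensive.

Import Order.TTheory GRing.Theory Num.Theory.
Import numFieldNormedType.Exports.

Local Open Scope classical_set_scope.
Local Open Scope ring_scope.

(** * Almost disjoint branches in the tree of finite sequences *)

Notation node := (seq nat + nat * seq nat)%type.

(** The [inl] codes are the shared nodes, the [inr] codes the private copies; [pickle] moves both
    into [nat], the index set of the target c_0. *)
Definition branch (j : nat * (nat -> nat)) : set nat :=
  [set p | exists m, (j.2 m = j.1 /\ p = pickle (inl (mkseq j.2 m) : node))
                     \/ p = pickle (inr (j.1, mkseq j.2 m) : node)].

Lemma mkseq_inj_size {T : Type} (a b : nat -> T) (l m : nat) :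
  mkseq a l = mkseq b m -> l = m.
Proof. by move=> /(congr1 size); rewrite !size_mkseq. Qed.

Lemma eq_mkseqP {T : Type} (a b : nat -> T) (m i : nat) :
  mkseq a m = mkseq b m -> (i < m)%N -> a i = b i.
Proof. by move=> /(congr1 (nth (a 0%N) ^~ i)) + im; rewrite !nth_mkseq. Qed.

Lemma branch_infinite j : ~ finite_set (branch j).
Proof.
pose h m : nat := pickle (inr (j.1, mkseq j.2 m) : node).
move=> fin; apply: infinite_nat.
rewrite (_ : [set: nat] = h @^-1` branch j); last first.
  by apply/seteqP; split=> // m _; exists m; right.
by apply: finite_preimage fin => l m _ _ /(pcan_inj pickleK)[] /mkseq_inj_size.
Qed.

(** Different labels on one sequence share no code: a node is followed by a single value, and
    private copies carry their label. Sequences that differ at [i] have no common node of length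
    above [i]. *)
Lemma branch_almost_disjoint j j' :
  j <> j' -> finite_set (branch j `&` branch j').
Proof.
case: j j' => [n a] [n' b] jj'.
have [eab|nab] := pselect (a = b).
  rewrite (_ : _ `&` _ = set0) // -subset0 => p []; subst b.
  have nn' : n <> n' by move=> e; apply: jj'; rewrite e.
  case=> m [[/= am ->]|/= ->] [l [[/= al]|/=]] => /(pcan_inj pickleK) // [].
    by move/mkseq_inj_size => lm; apply: nn'; rewrite -am lm.
  by move=> e; case: (nn' e).
have [i abi] : exists i, a i <> b i by apply/existsNP => /funext.
have abm m : mkseq a m = mkseq b m -> (m < i.+1)%N.
  by move=> e; rewrite ltnS leqNgt; apply/negP => /(eq_mkseqP e).
apply: (@sub_finite_set _ _
  ([set (pickle (inl (mkseq a m) : node) : nat) | m in `I_i.+1] `|`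
   [set (pickle (inr (n, mkseq a m) : node) : nat) | m in `I_i.+1])); last first.
  by rewrite finite_setU; split; apply/finite_image/finite_II.
move=> p [[m [[/= am ->]|/= ->]] [l [[/= al]|/=]]] => /(pcan_inj pickleK)[] //.
  by move=> e; left; exists m => //=; apply: abm; rewrite e (mkseq_inj_size e).
by move=> _ e; right; exists m => //=; apply: abm; rewrite e (mkseq_inj_size e).
Qed.

(* The Baire category theorem for [nat -> nat]. *)
Lemma nonmeager_covering (F : (nat -> nat) -> nat -> Prop) :
  (forall a, exists m, F a m) ->
  exists m s, forall t, exists2 a, mkseq a (size (s ++ t)) = s ++ t & F a m.
Proof.
move=> Fm; apply: contrapT => /forallNP nF.
have /choice[step stepP] : forall q : nat * seq nat, exists t,
    forall a, mkseq a (size (q.2 ++ t)) = q.2 ++ t -> ~ F a q.1.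
  move=> [m s]; have /forallNP/(_ s)/existsNP[t nt] := nF m.
  by exists t => a /= at_ Fa; apply: nt; exists a.
(* A sequence through every [u m] escapes every [F _ m]. The appended 0 forces the lengths to grow,
   so the limit [a] is determined everywhere. *)
pose fix u m := if m is l.+1 then rcons (u l ++ step (l, u l)) 0%N else [::].
have uS m : u m.+1 = u m ++ rcons (step (m, u m)) 0%N by rewrite /= rcons_cat.
have usize m : (m <= size (u m))%N.
  elim: m => // m IH; rewrite uS size_cat size_rcons addnS ltnS.
  exact: leq_trans IH (leq_addr _ _).
have uD m l : exists t, u (l + m)%N = u m ++ t.
  elim: l => [|l [t IH]]; first by exists [::]; rewrite cats0.
  by exists (t ++ rcons (step (l + m, u (l + m))%N) 0%N); rewrite addSn uS {1}IH catA.
pose a i := nth 0%N (u i.+1) i.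
have aE m : mkseq a (size (u m)) = u m.
  apply: (@eq_from_nth _ 0%N) => [|i]; rewrite size_mkseq // => iu.
  rewrite nth_mkseq // /a.
  have [t tE] := uD m i.+1; have [t' t'E] := uD i.+1 m.
  have : nth 0%N (u (i.+1 + m)%N) i = nth 0%N (u (m + i.+1)%N) i by rewrite addnC.
  by rewrite tE t'E !nth_cat iu usize => ->.
have [m Fa] := Fm a; apply: (stepP (m, u m) a _ Fa).
have /= := aE m.+1; rewrite size_rcons -cats1 -(addn1 (size _)) => e.
have /(congr1 (take (size (u m ++ step (m, u m))))) := e.
by rewrite take_size_cat // -map_take take_iota addn1 (minn_idPl (leqnSn _)).
Qed.

(** Each sequence has a level beyond which its shared nodes avoid the [k] finite sets attached to
    it. By Baire, one level [m] serves a dense set of sequences through some node [s]. *)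
Lemma branch_dense (k : nat) (E : nat * (nat -> nat) -> set nat) :
  (forall j, finite_set (E j)) ->
  exists p (a : nat -> nat -> nat), forall n, (n < k)%N ->
    branch (n, a n) p /\ ~ E (n, a n) p.
Proof.
move=> finE; pose pt a l : nat := pickle (inl (mkseq a l) : node).
have [|m [s sP]] := @nonmeager_covering (fun a m =>
    forall n l, (n < k)%N -> (m <= l)%N -> ~ E (n, a) (pt a l)).
  move=> a; elim: k => [|k [m IH]]; first by exists 0%N.
  have : finite_set (pt a @^-1` E (k, a)).
    apply: finite_preimage => // l l' _ _ /(pcan_inj pickleK)[].
    exact: mkseq_inj_size.
  move=> /finite_seqP[r rE]; exists (maxn m (\max_(i <- r) i).+1) => n l.
  rewrite ltnS leq_eqVlt geq_max => /orP[/eqP-> | nk] /andP[ml rl] El.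
    have lr : l \in r by have : [set` r] l by rewrite -rE.
    by have := @leq_bigmax_seq _ r predT id l lr isT; rewrite leqNgt rl.
  exact: IH El.
(* The padding brings the node to level at least [m], where the sets [E] are avoided. *)
pose s' := s ++ nseq m 0%N.
have /choice[a aP] : forall n, exists a, mkseq a (size s') = s' /\
    a (size s') = n /\ forall n l, (n < k)%N -> (m <= l)%N -> ~ E (n, a) (pt a l).
  (* Prescribing [n] as the value right after [s'] puts this node into [branch (n, a)]. *)
  move=> n; have [a] := sP (rcons (nseq m 0%N) n); rewrite -rcons_cat size_rcons.
  rewrite -/s' => e nE; exists a; split; last split=> //.
    have /(congr1 (take (size s'))) := e.
    by rewrite -cats1 take_size_cat // -map_take take_iota (minn_idPl (leqnSn _)).
  have /(congr1 (nth 0%N ^~ (size s'))) := e.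
  by rewrite nth_mkseq // nth_rcons ltnn eqxx.
exists (pickle (inl s' : node)), a => n nk; have [as' [an nE]] := aP n; split.
  by exists (size s'); left; rewrite as'.
have <- : pt (a n) (size s') = pickle (inl s' : node) by rewrite /pt as'.
by apply: nE => //; rewrite size_cat size_nseq leq_addl.
Qed.

(** * An injection of the sequences of naturals into a set of size continuum *)

Section embedding.
Context (R : realType).

Definition ternary_sum (b : nat -> bool) (m : nat) : R :=
  \sum_(i < m) (b i)%:R / 3 ^+ i.

Lemma ternary_sumS b m :
  ternary_sum b m.+1 = ternary_sum b m + (b m)%:R / 3 ^+ m.
Proof. by rewrite /ternary_sum big_ord_recr. Qed.

(** The added term is the geometric sum obtained when all digits from [l] to [l + k - 1] equal 1. *)
Lemma ternary_sum_tail b l k :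
  ternary_sum b (l + k) <=
    ternary_sum b l + 3 / 2 * ((3 ^+ l)^-1 - (3 ^+ (l + k))^-1).
Proof.
elim: k => [|k IH]; first by rewrite !addn0 subrr mulr0 addr0.
rewrite addnS ternary_sumS exprS invfM.
have t0 : 0 <= (3 ^+ (l + k))^-1 :> R by rewrite invr_ge0 exprn_ge0.
by case: (b _) IH => /= IH; rewrite ?mul1r ?mul0r; lra.
Qed.

Lemma ternary_sum_has_ubound b : has_ubound (range (ternary_sum b)).
Proof.
exists (3 / 2) => _ [m _ <-]; have := ternary_sum_tail b 0 m.
have : 0 <= (3 ^+ m)^-1 :> R by rewrite invr_ge0 exprn_ge0.
by rewrite add0n expr0 invr1 {2}/ternary_sum big_ord0; lra.
Qed.

Definition ternary (b : nat -> bool) : R := sup (range (ternary_sum b)).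

(** At the first differing digit [c] gains 3^-i, whereas all later digits of [b] together add at
    most half of that. *)
Lemma ternary_lt b c i : (forall l, (l < i)%N -> b l = c l) ->
  b i = false -> c i = true -> ternary b < ternary c.
Proof.
move=> bc bi ci; have w0 : 0 < (3 ^+ i)^-1 :> R by rewrite invr_gt0 exprn_gt0.
have sbc : ternary_sum b i = ternary_sum c i.
  by apply: eq_bigr => l _; rewrite bc.
have cge : ternary_sum c i + (3 ^+ i)^-1 <= ternary c.
  rewrite (_ : _ + _ = ternary_sum c i.+1); last by rewrite ternary_sumS ci mul1r.
  by apply: ub_le_sup; [exact: ternary_sum_has_ubound | exists i.+1].
apply: lt_le_trans cge; rewrite -sbc.
apply: (@le_lt_trans _ _ (ternary_sum b i + 2^-1 * (3 ^+ i)^-1)); last by lra.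
apply: ge_sup; first by exists (ternary_sum b 0), 0%N.
move=> _ [m _ <-].
(* Partial sums increase, so [m] may be replaced by an index beyond [i], where the tail bound
   applies. *)
apply: (@le_trans _ _ (ternary_sum b (i.+1 + m))).
  rewrite addnC -[leLHS]addr0 /ternary_sum big_split_ord /= lerD2l.
  by apply: sumr_ge0 => l _; rewrite divr_ge0 ?exprn_ge0.
apply: (le_trans (ternary_sum_tail _ _ _)).
have t0 : 0 <= (3 ^+ (i.+1 + m))^-1 :> R by rewrite invr_ge0 exprn_ge0.
rewrite ternary_sumS bi mul0r addr0 exprS invfM; lra.
Qed.

Lemma ternary_inj : injective ternary.
Proof.
move=> b c ebc; apply/funext; apply: contrapT => /existsNP[i0 nbc].
have ex : exists i, b i != c i by exists i0; apply/eqP.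
case: (ex_minnP ex) => i bci imin.
have bc l : (l < i)%N -> b l = c l.
  by move=> li; apply/eqP; apply: contraLR li => /imin; rewrite -leqNgt.
case bi : (b i) bci; case ci : (c i) => // _.
  have cb l : (l < i)%N -> c l = b l by move=> /bc.
  by have := ternary_lt cb ci bi; rewrite ebc ltxx.
by have := ternary_lt bc bi ci; rewrite ebc ltxx.
Qed.

(** A sequence is coded by the indicator of its graph, read as a real in base 3, and carried to [A]
    by a right inverse of the bijection with [R]. *)
Lemma card_continuum_embedding (A : Type) :
  card_continuum R A -> exists e : (nat -> nat) -> A, injective e.
Proof.
move=> /card_set_bijP[f [_ _ fsurj]].
have /choice[h hK] : forall r : R, exists a, f a = r.
  by move=> r; have [a _ <-] := fsurj r I; exists a.
pose graph (a : nat -> nat) c :=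
  if unpickle c is Some q then a q.1 == q.2 :> nat else false.
exists (fun a => h (ternary (graph a))) => a b /(congr1 f).
rewrite !hK => /ternary_inj eab; apply/funext => i.
have := congr1 (@^~ (pickle (i, b i))) eab.
by rewrite /graph pickleK /= eqxx => /eqP.
Qed.

End embedding.

(** This puts the exceptional set of a linear combination inside the union of two exceptional sets;
    the 1 added to the modulus of [a] covers [a = 0]. *)
Lemma ler_normDZ (R : realFieldType) (a e s t : R) :
  0 < e -> e <= `|a * s + t| -> e / 2 / (`|a| + 1) <= `|s| \/ e / 2 <= `|t|.
Proof.
move=> e0 est; have [|lt_t] := leP (e / 2) `|t|; [by right|left].
rewrite ler_pdivrMr ?ltr_wpDl //.
have := ler_normD (a * s) t; rewrite normrM => tri.
rewrite mulrDr mulr1 [leRHS]addrC ler_wpDl // mulrC; lra.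
Qed.

(** * The pullback space and its norm *)

Section extension.
Context (R : realType) (J : Type) (S : J -> set nat).
Context (X : completeNormedModType R) (G : J -> {linear X -> R^o}).

(* [w.1] equals [\sum_i G i w.2 * 1_(S i)] modulo c_0, without naming the sum. *)
Definition extends (w : (nat -> R) * X) : Prop :=
  [/\ exists M, forall p, `|w.1 p| <= M,
      forall i e, 0 < e -> finite_set [set p | S i p /\ e <= `|w.1 p - G i w.2|]
    & forall e, 0 < e -> exists2 F : set J, finite_set F &
        finite_set [set p | (forall i, F i -> ~ S i p) /\ e <= `|w.1 p|]].

Definition ext_pred : {pred (nat -> R) * X} :=
  [pred w : (nat -> R) * X | `[< extends w >]].

Lemma ext_predP w : reflect (extends w) (w \in ext_pred).
Proof. exact: asboolP. Qed.

Lemma ext_submod_closed : submod_closed ext_pred.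
Proof.
split=> [|a w w' /ext_predP[[M wM] w1 w2] /ext_predP[[M' wM'] w'1 w'2]];
    apply/ext_predP; split.
- by exists 0 => p; rewrite normr0.
- move=> i e e0; rewrite (_ : [set _ | _] = set0) // -subset0 => p /= [_].
  by rewrite linear0 subr0 normr0 leNgt e0.
- move=> e e0; exists set0 => //.
  rewrite (_ : [set _ | _] = set0) // -subset0 => p /= [_].
  by rewrite normr0 leNgt e0.
- exists (`|a| * M + M') => p.
  by rewrite (le_trans (ler_normD _ _)) // lerD // normrM ler_wpM2l.
- move=> i e e0.
  apply: (@sub_finite_set _ _
    ([set p | S i p /\ e / 2 / (`|a| + 1) <= `|w.1 p - G i w.2|] `|`
     [set p | S i p /\ e / 2 <= `|w'.1 p - G i w'.2|])); last first.
    rewrite finite_setU; split; first by apply: w1; rewrite !divr_gt0 ?ltr_wpDl.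
    by apply: w'1; rewrite divr_gt0.
  move=> p [Sp] /=.
  rewrite linearP (_ : _ - _ = a * (w.1 p - G i w.2) + (w'.1 p - G i w'.2)).
    by move=> /(ler_normDZ e0)[]; [left | right].
  by rewrite mulrBr opprD addrACA.
- move=> e e0.
  have [|F finF wF] := w2 (e / 2 / (`|a| + 1)); first by rewrite !divr_gt0 ?ltr_wpDl.
  have [|F' finF' w'F] := w'2 (e / 2); first by rewrite divr_gt0.
  exists (F `|` F'); first by rewrite finite_setU.
  apply: sub_finite_set (_ : finite_set (_ `|` _)); last first.
    by rewrite finite_setU; split; [exact: wF | exact: w'F].
  move=> p /= [nS /(ler_normDZ e0)[le|le]]; [left | right]; split=> // i Fi.
    by apply: nS; left.
  by apply: nS; right.
Qed.

Record ext := MkExt { ext_val : (nat -> R) * X ; ext_valP : ext_val \in ext_pred }.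

HB.instance Definition _ := [isSub for ext_val].
HB.instance Definition _ := [Choice of ext by <:].
HB.instance Definition _ := GRing.isSubmodClosed.Build R ((nat -> R) * X)%type ext_pred
  ext_submod_closed.
HB.instance Definition _ := [SubChoice_isSubLmodule of ext by <:].

Definition ext_seq (w : ext) : nat -> R := (ext_val w).1.
Definition ext_vec (w : ext) : X := (ext_val w).2.

Lemma ext_extends (w : ext) : extends (ext_seq w, ext_vec w).
Proof. by case: w => -[z v] wP; apply/ext_predP. Qed.

Lemma ext_ext (w w' : ext) : ext_seq w =1 ext_seq w' -> ext_vec w = ext_vec w' -> w = w'.
Proof.
move=> /funext; rewrite /ext_seq /ext_vec => ez ev; apply: val_inj => /=.
by rewrite [LHS]surjective_pairing [RHS]surjective_pairing ez ev.
Qed.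

Lemma ext_seqB w w' p : ext_seq (w - w') p = ext_seq w p - ext_seq w' p.
Proof. by []. Qed.

Lemma ext_seq_is_linear : linear ext_seq.
Proof. by []. Qed.
HB.instance Definition _ := GRing.isLinear.Build R ext (nat -> R) _ ext_seq ext_seq_is_linear.

Lemma ext_vec_is_linear : linear ext_vec.
Proof. by []. Qed.
HB.instance Definition _ := GRing.isLinear.Build R ext X _ ext_vec ext_vec_is_linear.

Definition sup_norm (w : ext) : R := sup (range (fun p => `|ext_seq w p|)).

Lemma sup_norm_ub w p : `|ext_seq w p| <= sup_norm w.
Proof.
apply: ub_le_sup; last by exists p.
by have [[M wM] _ _] := ext_extends w; exists M => _ [q _ <-]; exact: wM.
Qed.

Lemma sup_norm_le w M : (forall p, `|ext_seq w p| <= M) -> sup_norm w <= M.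
Proof.
by move=> wM; apply: ge_sup => [|_ [p _ <-]//]; exists `|ext_seq w 0%N|, 0%N.
Qed.

Lemma sup_norm_ge0 w : 0 <= sup_norm w.
Proof. exact: le_trans (normr_ge0 _) (sup_norm_ub w 0). Qed.

Definition ext_norm (w : ext) : R := sup_norm w + `|ext_vec w|.

Lemma ext_ler_normD w w' : ext_norm (w + w') <= ext_norm w + ext_norm w'.
Proof.
rewrite /ext_norm addrACA linearD lerD ?ler_normD //.
apply: sup_norm_le => p; rewrite linearD.
by rewrite (le_trans (ler_normD _ _)) // lerD ?sup_norm_ub.
Qed.

Lemma ext_normrZ (a : R) w : ext_norm (a *: w) = `|a| * ext_norm w.
Proof.
rewrite /ext_norm linearZ /= normrZ mulrDr; congr (_ + _).
have le b u : sup_norm (b *: u) <= `|b| * sup_norm u.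
  by apply: sup_norm_le => p; rewrite linearZ /= normrM ler_wpM2l ?sup_norm_ub.
apply/eqP; rewrite eq_le le /=.
have [->|a0] := eqVneq a 0; first by rewrite normr0 mul0r sup_norm_ge0.
by rewrite -ler_pdivlMl ?normr_gt0 // -normfV -{1}[w]scale1r -(mulVf a0) -scalerA le.
Qed.

Lemma ext_normr0_eq0 w : ext_norm w = 0 -> w = 0.
Proof.
move=> w0; have s0 := sup_norm_ge0 w; have v0 := normr_ge0 (ext_vec w).
move: w0; rewrite /ext_norm => w0.
apply: ext_ext => [p|].
  apply/eqP; rewrite linear0 -normr_le0 (le_trans (sup_norm_ub w p)) //; lra.
by apply/eqP; rewrite linear0 -normr_le0; lra.
Qed.

HB.instance Definition _ := @Lmodule_isNormed.Build R ext ext_norm ext_ler_normD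
  ext_normrZ ext_normr0_eq0.

Lemma ext_seq_norm w p : `|ext_seq w p| <= `|w|.
Proof. by rewrite (le_trans (sup_norm_ub w p)) // lerDl. Qed.

Lemma ext_vec_norm w : `|ext_vec w| <= `|w|.
Proof. by rewrite lerDr sup_norm_ge0. Qed.

(** * Completeness of the pullback space *)

Hypothesis S_infinite : forall i, ~ finite_set (S i).

(* [ext_seq w] tends to [G i (ext_vec w)] along the infinite set [S i]; this spares
   the uniform boundedness principle. *)
Lemma functional_norm i w : `|G i (ext_vec w)| <= `|w|.
Proof.
apply/ler_addgt0Pr => e e0; rewrite leNgt; apply/negP => lt_w.
have [_ /(_ i _ e0) fin _] := ext_extends w.
apply: (S_infinite (i := i)); apply: sub_finite_set fin => p Sp; split=> //=.
have := ler_distD 0 (G i (ext_vec w)) (ext_seq w p).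
have := ext_seq_norm w p.
have := lerB_dist (G i (ext_vec w)) (ext_seq w p).
rewrite distrC; lra.
Qed.

Hypothesis G_bounded : forall i, bounded_operator (G i).

Lemma ext_complete (F : set_system ext) : ProperFilter F -> cauchy F -> cvg F.
Proof.
move=> FF Fc.
have ex e : 0 < e -> exists x : ext, \forall u \near F, `|x - u| < e.
  move=> e0; have /cauchyP/(_ e e0)[x Fx] := Fc.
  by exists x; apply: filterS Fx => u; rewrite -ball_normE.
(* The candidate limit is pointwise in the sequence and in norm in [X]; the error bounds below are
   uniform in [p], which preserves the finiteness conditions. *)
pose z p := lim ((fun u => ext_seq u p) @ F).
have zP p : (fun u => ext_seq u p) @ F --> z p.
  apply: R_complete; apply/cauchyP => e e0.
  have [x Fx] := ex e e0; exists (ext_seq x p); apply: filterS Fx => u xu.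
  rewrite -ball_normE /=; apply: le_lt_trans xu.
  exact: ext_seq_norm (x - u) p.
pose v := lim (ext_vec @ F).
have vP : ext_vec @ F --> v.
  apply/cauchy_cvgP/cauchyP => e e0.
  have [x Fx] := ex e e0; exists (ext_vec x); apply: filterS Fx => u xu.
  rewrite -ball_normE /=; apply: le_lt_trans xu.
  by rewrite -linearB; exact: ext_vec_norm.
have near_seq e (x : ext) : (\forall u \near F, `|x - u| < e) ->
    forall p, `|ext_seq x p - z p| <= e.
  move=> Fx p; apply/ler_addgt0Pr => d d0; near F => u.
  rewrite -(subrKA (ext_seq u p)) (le_trans (ler_normD _ _)) // lerD //.
    rewrite (le_trans (ext_seq_norm (x - u) p)) // ltW //.
    by near: u; exact: Fx.
  rewrite distrC; near: u; move/cvgrPdist_le : (zP p); exact.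
have near_vec e (x : ext) : (\forall u \near F, `|x - u| < e) ->
    `|ext_vec x - v| <= e.
  move=> Fx; apply/ler_addgt0Pr => d d0; near F => u.
  rewrite -(subrKA (ext_vec u)) (le_trans (ler_normD _ _)) // lerD //.
    rewrite -linearB (le_trans (ext_vec_norm _)) // ltW //.
    by near: u; exact: Fx.
  rewrite distrC; near: u; move/cvgrPdist_le : vP; exact.
have near_fun e (x : ext) : (\forall u \near F, `|x - u| < e) ->
    forall i, `|G i (ext_vec x) - G i v| <= e.
  move=> Fx i; have GvP : (fun u => G i (ext_vec u)) @ F --> G i v.
    have Gc : continuous (G i) by apply/bounded_operatorP.
    exact: (cvg_comp _ _ vP (Gc v)).
  apply/ler_addgt0Pr => d d0; near F => u.
  rewrite -(subrKA (G i (ext_vec u))) (le_trans (ler_normD _ _)) // lerD //.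
    rewrite -!linearB (le_trans (functional_norm i (x - u))) // ltW //.
    by near: u; exact: Fx.
  rewrite distrC; near: u; move/cvgrPdist_le : GvP; exact.
have wP : (z, v) \in ext_pred.
  apply/ext_predP; split.
  - have [x /near_seq xz] := ex 1 ltr01; exists (sup_norm x + 1) => p.
    have := lerB_dist (z p) (ext_seq x p).
    rewrite distrC; have := xz p; have := sup_norm_ub x p; rewrite /=; lra.
  - move=> i e e0; have [|x Fx] := ex (e / 4); first by rewrite divr_gt0.
    have xz := near_seq _ _ Fx; have xv := near_fun _ _ Fx i.
    have [_ /(_ i (e / 4)) fin _] := ext_extends x.
    apply: sub_finite_set (fin _); last by rewrite divr_gt0.
    move=> p /= [Sp le_e]; split=> //; have := xz p.
    have := ler_distD (ext_seq x p) (z p) (G i v).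
    have := ler_distD (G i (ext_vec x)) (ext_seq x p) (G i v).
    rewrite (distrC (z p) (ext_seq x p)); lra.
  - move=> e e0; have [|x Fx] := ex (e / 2); first by rewrite divr_gt0.
    have xz := near_seq _ _ Fx.
    have [_ _ /(_ (e / 2))[|D finD fin]] := ext_extends x.
      by rewrite divr_gt0.
    exists D => //; apply: sub_finite_set fin => p /= [nS le_e]; split=> //.
    have := lerB_dist (z p) (ext_seq x p); have := xz p.
    rewrite distrC; lra.
apply/cvg_ex; exists (MkExt wP); apply/cvgrPdist_le => /= e e0.
(* Passing through [x] costs two quarters in the sequence part and two in the vector part. *)
have [|x Fx] := ex (e / 4); first by rewrite divr_gt0.
apply: filterS (Fx) => u xu.
have xz := near_seq _ _ Fx; have xv := near_vec _ _ Fx.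
have le_sup : sup_norm (MkExt wP - u) <= e / 2.
  apply: sup_norm_le => p; rewrite ext_seqB -[ext_seq (MkExt wP) p]/(z p).
  have := ler_distD (ext_seq x p) (z p) (ext_seq u p).
  have := xz p; rewrite (distrC (z p) (ext_seq x p)).
  have := ext_seq_norm (x - u) p; rewrite ext_seqB; lra.
have le_vec : `|ext_vec (MkExt wP - u)| <= e / 2.
  rewrite linearB /= -[ext_vec (MkExt wP)]/v.
  have := ler_distD (ext_vec x) v (ext_vec u).
  rewrite (distrC v (ext_vec x)); have := ext_vec_norm (x - u); rewrite linearB /=; lra.
by rewrite (splitr e); apply: lerD.
Unshelve. all: by end_near. Qed.

(** Packed by hand because completeness rests on the section hypotheses. *)
Definition ext_banach : completeNormedModType R :=
  HB.pack ext (Uniform_isComplete.Build ext ext_complete).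

(** * Lifting of vectors and exactness of the sequence *)

Hypothesis S_disjoint : forall i j, i <> j -> finite_set (S i `&` S j).
Hypothesis G_null : weak_star_null G.

(* At [p] the lift takes a value [G j v] with [p] in [S j] whose modulus is at
   least half of the supremum, so no other [G i v] with [p] in [S i] matters. *)
Lemma ext_lift v : exists2 w : ext, ext_vec w = v &
  forall M, 0 <= M -> (forall i, `|G i v| <= M) -> forall p, `|ext_seq w p| <= M.
Proof.
pose c : c0 R J := C0 (introT (c0_predP _) (G_null v)).
have /choice[z zP] : forall p, exists r, (forall i, S i p -> `|G i v| <= 2 * `|r|) /\
    (r = 0 \/ exists2 j, S j p & r = G j v).
  move=> p; pose E := [set `|G i v| | i in [set i | S i p]].
  have ubE : has_ubound E by exists (c0_norm c) => _ [i _ <-]; exact: (c0_norm_ub c i).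
  have [[i Si Gi]|] := pselect (exists2 i, S i p & G i v != 0); last first.
    (* The default 0 serves the points [p] at which every [G i v] with [S i p] vanishes. *)
    move=> /forall2NP nG; exists 0; split=> [i Si|]; last by left.
    by have [//|/negP/negbNE/eqP->] := nG i; rewrite normr0 mulr0.
  have supE0 : 0 < sup E.
    apply: (@lt_le_trans _ _ `|G i v|); rewrite ?normr_gt0 //.
    by apply: ub_le_sup => //; exists i.
  have ltE : sup E / 2 < sup E by lra.
  have [_ [j Sj <-] ltj] := sup_gt (ex_intro _ _ (ex_intro2 _ _ i Si erefl)) ltE.
  exists (G j v); split=> [l Sl|]; last by right; exists j.
  have : `|G l v| <= sup E by apply: ub_le_sup => //; exists l.
  lra.
have wP : (z, v) \in ext_pred.
  apply/ext_predP; split.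
  - exists (c0_norm c) => p /=.
    have [_ [->|[j _ ->]]] := zP p; first by rewrite normr0 c0_norm_ge0.
    exact: (c0_norm_ub c j).
  - move=> i e e0; have e3 : 0 < e / 3 by rewrite divr_gt0.
    (* Since [G i v] has modulus at most twice that of [z p], a gap of at least [e] forces [z p] to
       have modulus at least [e / 3]. Hence [z p] is [G j v] for one of finitely many [j] other than
       [i], and [p] lies in the finite set where [S i] and [S j] meet. *)
    pose D := [set j | e / 3 <= `|G j v|] `&` [set j | i <> j].
    apply: (@sub_finite_set _ _ (\bigcup_(j in D) (S i `&` S j))); last first.
      apply: bigcup_finite => [|j [_ /= ij]]; last exact: S_disjoint.
      by apply: sub_finite_set (G_null v e3); exact: subIsetl.
    move=> p /= [Si le_e]; have [/(_ i Si) leG zG] := zP p.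
    have le3 : e / 3 <= `|z p| by have := ler_normB (z p) (G i v); lra.
    case: zG => [z0|[j Sj zj]].
      by move: le3; rewrite z0 normr0 => ?; exfalso; lra.
    exists j => //; split; first by rewrite /= -zj.
    by move=> /= ij; move: le_e; rewrite zj ij subrr normr0 => ?; lra.
  - move=> e e0; exists [set j | e <= `|G j v|]; first exact: G_null.
    rewrite (_ : [set _ | _] = set0) // -subset0 => p /= [nS le_e].
    have [_ [z0|[j Sj zj]]] := zP p; last by apply: (nS j) => //=; rewrite -zj.
    by move: le_e; rewrite z0 normr0 leNgt e0.
exists (MkExt wP) => // M M0 GM p; rewrite -[ext_seq _ p]/(z p).
by have [_ [->|[j _ ->]]] := zP p; rewrite ?normr0.
Qed.

Lemma c0_extends (y : c0 R nat) : (c0_val y, 0) \in ext_pred.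
Proof.
apply/ext_predP; split.
- by exists (c0_norm y) => p; exact: c0_norm_ub.
- move=> i e e0; apply: sub_finite_set (c0_vanishing y e0) => p [_] /=.
  by rewrite linear0 subr0.
- move=> e e0; exists set0 => //.
  by apply: sub_finite_set (c0_vanishing y e0) => p [_].
Qed.

Definition ext_inj (y : c0 R nat) : ext := MkExt (c0_extends y).

Lemma ext_inj_is_linear : linear ext_inj.
Proof. by move=> a y y'; apply: ext_ext => //=; rewrite linearP /= scaler0 addr0. Qed.
HB.instance Definition _ :=
  GRing.isLinear.Build R (c0 R nat) ext _ ext_inj ext_inj_is_linear.

Lemma ext_inj_bounded : @bounded_operator R (c0 R nat) ext_banach ext_inj.
Proof.
exists 1 => y; rewrite mul1r -[leLHS]/(sup_norm (ext_inj y) + `|0 : X|) normr0 addr0.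
by apply: sup_norm_le => p; exact: c0_norm_ub.
Qed.

Lemma ext_vec_bounded : @bounded_operator R ext_banach X ext_vec.
Proof. by exists 1 => w; rewrite mul1r; exact: ext_vec_norm. Qed.

Lemma ext_inj_injective : injective ext_inj.
Proof. by move=> y y' /(congr1 ext_seq) e; apply: c0P => p; move/(congr1 (@^~ p)): e. Qed.

(** Over the vector 0 the sequence tends to 0 along each [S i], and outside finitely many [S i] it
    is below [e] off a finite set; together these give membership in c_0. *)
Lemma ext_exact : range ext_inj = [set w | ext_vec w = 0].
Proof.
apply/seteqP; split=> [_ [y _ <-]//|w /= w0].
have wc0 : ext_seq w \in @c0_pred R nat.
  apply/c0_predP => e e0; have [_ wS /(_ e e0)[D finD wD]] := ext_extends w.
  apply: (@sub_finite_set _ _ ([set p | (forall i, D i -> ~ S i p) /\ e <= `|ext_seq w p|]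
    `|` \bigcup_(i in D) [set p | S i p /\ e <= `|ext_seq w p - G i (ext_vec w)|])).
    2: by rewrite finite_setU; split=> //; apply: bigcup_finite => // i _; exact: wS.
  move=> p /= ep; have [[i Di Si]|/forall2NP nS] := pselect (exists2 i, D i & S i p).
    by right; exists i => //=; rewrite w0 linear0 subr0.
  by left; split=> // i Di; have [] := nS i.
by exists (C0 wc0) => //; apply: ext_ext => //; rewrite w0.
Qed.

Lemma ext_surjective : range ext_vec = [set: X].
Proof. by apply/seteqP; split=> // v _; have [w wv _] := ext_lift v; exists w. Qed.

Definition ext_twisted_sum : twisted_sum (c0 R nat) X :=
  @TwistedSum R (c0 R nat) X ext_banach ext_inj ext_vec ext_inj_bounded ext_vec_bounded
    ext_inj_injective ext_exact ext_surjective.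

(** * Absence of a bounded retraction *)

Lemma ext_nontrivial (x : J -> X) (C : R) :
  (forall i, G i (x i) = 1) ->
  (forall (k : nat) (E : J -> set nat), (forall j, finite_set (E j)) ->
    exists p, exists2 j : 'I_k.+1 -> J, forall n, S (j n) p /\ ~ E (j n) p &
      `|\sum_(n < k.+1) x (j n)| <= C /\ forall i, `|G i (\sum_(n < k.+1) x (j n))| <= 1) ->
  ~ trivial_twisted_sum ext_twisted_sum.
Proof.
move=> Gx dense [/= r [M rM] rK].
have /choice[W WP] : forall j, exists w, ext_vec w = x j.
  by move=> j; have [w] := ext_lift (x j); exists w.
(* On [S j] outside [E j], the lift [W j] is within 1/4 of 1 and its retraction is below 1/4 in
   modulus, so their difference exceeds 1/2. *)
pose E j := [set p | S j p /\ 4^-1 <= `|ext_seq (W j) p - G j (ext_vec (W j))|]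
  `|` [set p | 4^-1 <= `|r (W j) p|].
have e4 : 0 < 4^-1 :> R by rewrite invr_gt0.
have finE j : finite_set (E j).
  rewrite finite_setU; split; last exact: c0_vanishing.
  by have [_ + _] := ext_extends (W j); exact.
(* [B] bounds [T w], as the lift [w] has norm at most [1 + C]; [k] exceeds [2 * B], so [k.+1] terms
   of size at least 1/2 contradict it. *)
pose B := 1 + `|M| * (1 + C); pose k := Num.bound (2 * B).
have [p [j jP [sC sG]]] := dense k E finE.
set s := \sum_(n < _) _ in sC sG.
have [w wv /(_ 1 ler01 sG) w1] := ext_lift s.
(* [w] and the sum of the [W (j n)] lift the same vector, so [d] comes from c_0, where [r] is the
   identity and [T] vanishes. *)
pose d := w - \sum_n W (j n).
have [y _ yd] : range ext_inj d.
  rewrite ext_exact /= /d linearB /= wv linear_sum /=.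
  by apply/eqP; rewrite subr_eq0; apply/eqP/eq_bigr => n _; rewrite WP.
pose T (u : ext) := ext_seq u p - r u p.
have rB u u' : r (u - u') p = r u p - r u' p.
  exact: (congr1 (fun y : c0 R nat => y p) (linearB r u u')).
have TB u u' : T (u - u') = T u - T u' by rewrite /T ext_seqB rB; lra.
have T0 : T 0 = 0 by rewrite -(subrr 0) TB subrr.
have TD u u' : T (u + u') = T u + T u'.
  have -> : u + u' = u - (0 - u') by rewrite sub0r opprK.
  by rewrite !TB T0 sub0r opprK.
have Td : T d = 0 by rewrite /T -yd rK subrr.
have Tw : T w = \sum_n T (W (j n)).
  by rewrite -(big_morph _ TD T0); apply/eqP; rewrite -subr_eq0 -TB Td.
have le_T n : 2^-1 <= T (W (j n)).
  have [Sp nE] := jP n; rewrite /T.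
  have near1 : `|ext_seq (W (j n)) p - 1| < 4^-1.
    by rewrite ltNge; apply/negP => le4; apply: nE; left; rewrite /= WP Gx.
  have near0 : `|r (W (j n)) p| < 4^-1.
    by rewrite ltNge; apply/negP => le4; apply: nE; right.
  by move: near1 near0; rewrite !ltr_norml => /andP[+ _] /andP[_]; lra.
have ge_Tw : k.+1%:R / 2 <= T w.
  rewrite Tw (le_trans _ (ler_sum _ (fun n _ => le_T n))) //.
  by rewrite sumr_const card_ord mulr_natl.
have le_Tw : T w <= B.
  apply: (le_trans (ler_norm _)); apply: (le_trans (ler_normB _ _)).
  apply: lerD => //; apply: (le_trans (c0_norm_ub _ _)); apply: (le_trans (rM w)).
  apply: (@le_trans _ _ (`|M| * `|w|)); first by rewrite ler_wpM2r // ler_norm.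
  by rewrite ler_wpM2l // lerD ?wv //; exact: sup_norm_le.
have C0 : 0 <= C := le_trans (normr_ge0 _) sC.
have B0 : 0 <= 2 * B by rewrite mulr_ge0 // addr_ge0 // mulr_ge0 // addr_ge0.
have := archi_boundP B0; rewrite -/k -natr1 in ge_Tw *; lra.
Qed.

End extension.

(** * Application to the biorthogonal system *)

Theorem theorem2p3 (R : realType) (X : completeNormedModType R)
    (A : Type) (hA : card_continuum R A)
    (x : nat * A -> X) (g : nat * A -> {linear X -> R^o})
    (hbi : biorthogonal_system x g) (hnull : weak_star_null g)
    (C : R) (hC : 0 <= C)
    (hbound : forall (k : nat) (n : 'I_k -> nat) (a : 'I_k -> A),
      (1 <= k)%N -> injective n ->
      `|\sum_(i < k) x (n i, a i)| <= C) :
  Ext_neq0 X (c0 R nat).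
Proof.
have [e e_inj] := card_continuum_embedding hA.
have [g_bounded g_diag g_off] := hbi.
(* The system is restricted to the indices that come from branches. *)
pose idx (i : nat * (nat -> nat)) := (i.1, e i.2).
have idx_inj : injective idx by move=> [n a] [m b] [-> /e_inj->].
have null : weak_star_null (fun i => g (idx i)).
  move=> v d d0; apply: (finite_preimage _ (hnull v d d0)).
  by move=> i j _ _; exact: idx_inj.
exists (ext_twisted_sum branch_infinite (fun i => g_bounded (idx i))
  branch_almost_disjoint null).
apply: (@ext_nontrivial _ _ _ _ _ _ _ _ _ (fun i => x (idx i)) C).
  by move=> i; exact: g_diag.
move=> k E finE; have [p [a aP]] := branch_dense k.+1 finE.
exists p, (fun n : 'I_k.+1 => (val n, a n)); first by move=> n; exact: (aP _ (ltn_ord n)).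
split; first by apply: hbound => //; exact: val_inj.
(* By biorthogonality the functional takes the value 1 on the sum if its index is one of those
   summed, and 0 otherwise. *)
move=> i; rewrite linear_sum /=.
have [[n in_]|/forallNP ni] := pselect (exists n : 'I_k.+1, i = (val n, a n)).
  rewrite (bigD1 n) //= -in_ g_diag big1 ?addr0 ?normr1 // => m mn.
  apply: g_off; rewrite in_ => -[] /val_inj nm.
  by rewrite nm eqxx in mn.
rewrite big1 ?normr0 // => n _; apply: g_off => /idx_inj; exact: ni.
Qed.
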